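(* Let $G$ be a finite commutative group. Let $m=p_1^{r_1}p_2^{r_2}\cdots p_j^{r_j}$ be the prime factorization of the integer $m\geq 2$. Set $m_i=m/p_i^{r_i}$ and let $s_i$ be a natural number such that $s_im_i\equiv 1 \pmod{p_i^{r_i}}$ for $i=1,2,\dots,j$. If $\bar f_i$ is an invertible element of the group ring $\mathbb{Z}_{p_i}G$ for $i=1,2,\dots,j$, then \[f=s_1m_1f_1+s_2m_2f_2+\cdots+s_jm_jf_j\] is an invertible element of the group ring $\mathbb{Z}_mG$, with \[f^{-1}=s_1m_1g_1^{\alpha_1}f_1^{\alpha_1-1}+s_2m_2g_2^{\alpha_2}f_2^{\alpha_2-1}+\cdots+s_jm_jg_j^{\alpha_j}f_j^{\alpha_j-1},\] where $\alpha_i=p_i^{r_i-1}$ and $\bar g_i\in\mathbb{Z}_{p_i}G$ is such that $\bar f_i\bar g_i=\bar 1$. Moreover, \[|(\mathbb{Z}_mG)^{\ast}|=\left(\frac{m}{p_1p_2\cdots p_j}\right)^{|G|}|(\mathbb{Z}_{p_1}G)^{\ast}|\,|(\mathbb{Z}_{p_2}G)^{\ast}|\cdots|(\mathbb{Z}_{p_j}G)^{\ast}|.\]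
   Context: $\mathbb{Z}_m$ is the ring of integers modulo $m$, $AG$ denotes the group ring of $G$ over $A$, and $A^{\ast}$ denotes the group of invertible elements of a ring $A$. The primes $p_1,\dots,p_j$ are distinct and $r_i\ge 1$. Here $f_i,g_i$ are elements of the integral group ring $\mathbb{Z}G$ (arbitrary representatives of their classes), $\bar f_i,\bar g_i$ are their images in $\mathbb{Z}_{p_i}G$ under reduction of coefficients modulo $p_i$, and the displayed formulas for $f$ and $f^{-1}$ are read in $\mathbb{Z}_mG$ by reducing coefficients modulo $m$. *)

(* Defs.v *)
From HB Require Import structures.
From mathcomp Require Import all_boot all_order all_algebra all_fingroup.

Set Implicit Arguments.
Unset Strict Implicit.
Unset Printing Implicit Defensive.

Import GRing.Theory.
Local Open Scope ring_scope.

(* An element of the group ring is its coefficient function: f stands for the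
   formal sum of the f x * x.  The alias keeps the convolution product below
   apart from the pointwise ring structure of {ffun gT -> R}. *)
Definition group_ring (R : nzRingType) (gT : finGroupType) := {ffun gT -> R}.

Section GroupRing.
Variables (R : nzRingType) (gT : finGroupType).
Local Notation RG := (group_ring R gT).
Implicit Types f g h : RG.

HB.instance Definition _ := GRing.Zmodule.on RG.

Definition gr_one : RG := [ffun x => (x == 1%g)%:R].
(* The coefficient at x collects the pairs (y, z) with y * z = x. *)
Definition gr_mul f g : RG := [ffun x => \sum_y f y * g (y^-1 * x)%g].

Fact gr_mulA : associative gr_mul.
Proof.
move=> f g h; apply/ffunP=> x; rewrite !ffunE.
under eq_bigr => y _ do rewrite ffunE mulr_sumr.
rewrite [RHS](eq_bigr (fun z => \sum_y f y * g (y^-1 * z)%g * h (z^-1 * x)%g));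
  last by move=> z _; rewrite ffunE mulr_suml.
rewrite [RHS]exchange_big /=; apply: eq_bigr => y _.
rewrite [RHS](reindex_inj (mulgI y)) /=; apply: eq_bigr => z _.
by rewrite mulKg invMg !mulgA mulrA.
Qed.

Fact gr_mul1l : left_id gr_one gr_mul.
Proof.
move=> f; apply/ffunP=> x; rewrite ffunE (bigD1 1%g) //= !ffunE eqxx mul1r.
rewrite invg1 mul1g big1 ?addr0 // => y /negPf yN1.
by rewrite ffunE yN1 mul0r.
Qed.

Fact gr_mul1r : right_id gr_one gr_mul.
Proof.
move=> f; apply/ffunP=> x; rewrite ffunE (bigD1 x) //= !ffunE mulVg eqxx mulr1.
rewrite big1 ?addr0 // => y yNx.
by rewrite ffunE -eq_invg_mul invgK (negPf yNx) mulr0.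
Qed.

Fact gr_mulDl : left_distributive gr_mul +%R.
Proof.
move=> f g h; apply/ffunP=> x; rewrite !ffunE -big_split /=.
by apply: eq_bigr => y _; rewrite ffunE mulrDl.
Qed.

Fact gr_mulDr : right_distributive gr_mul +%R.
Proof.
move=> f g h; apply/ffunP=> x; rewrite !ffunE -big_split /=.
by apply: eq_bigr => y _; rewrite ffunE mulrDr.
Qed.

Fact gr_one_neq0 : gr_one != 0.
Proof.
by apply/eqP=> /ffunP/(_ 1%g)/eqP; rewrite !ffunE eqxx oner_eq0.
Qed.

HB.instance Definition _ := GRing.Zmodule_isNzRing.Build RG
  gr_mulA gr_mul1l gr_mul1r gr_mulDl gr_mulDr gr_one_neq0.

Lemma group_ring1E x : (1 : RG) x = (x == 1%g)%:R.
Proof. by rewrite ffunE. Qed.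

Lemma group_ringME f g x : (f * g) x = \sum_y f y * g (y^-1 * x)%g.
Proof. by rewrite ffunE. Qed.

End GroupRing.

(* Over a finite coefficient ring, units are the elements with a two-sided
   inverse, and {unit group_ring R gT} is the group they form. *)
HB.instance Definition _ (R : finNzRingType) (gT : finGroupType) :=
  Finite.on (group_ring R gT).
HB.instance Definition _ (R : finNzRingType) (gT : finGroupType) :=
  FinRing.isNzRing.Build (group_ring R gT).

(* Meant for 1 < n only, as 'Z_0 and 'Z_1 denote the integers modulo 2. *)
Definition group_ring_mod (n : nat) (gT : finGroupType)
    (f : group_ring int gT) : group_ring 'Z_n gT :=
  [ffun x => (f x)%:~R].

(* Main.v *)
Require Import Defs.
From HB Require Import structures.
From mathcomp Require Import all_boot all_order all_algebra all_fingroup.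

Set Implicit Arguments.
Unset Strict Implicit.
Unset Printing Implicit Defensive.

Import GRing.Theory.
Local Open Scope ring_scope.

(** Write red n for the reduction ZG -> (Z/n)G, a ring morphism whose kernel is
    n ZG.  Since m is the product of the coprime prime powers p_i ^ r_i, an
    identity of (Z/m)G may be checked modulo each p_i ^ r_i separately
    (group_ring_mod_chinese).  Modulo p_i ^ r_i the coefficient s_k m_k is 1 if
    k = i and 0 otherwise, so the sum f of the s_k m_k f_k reduces to f_i, and
    the proposed inverse to g_i ^ alpha_i * f_i ^ (alpha_i - 1); as ZG is
    commutative, their product is (f_i g_i) ^ alpha_i.  This is 1 modulo
    p_i ^ r_i because f_i g_i is 1 modulo p_i and raising to the power p_i
    improves a congruence to 1 by one more factor p_i
    (group_ring_mod_exp_lift).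

    Applied to f_i = f for all i, this shows that f is invertible modulo m if
    and only if it is invertible modulo every p_i (unit_group_ring_modE).  The
    number of units then follows by counting coefficients: with P the product
    of the p_i, an integer c with 0 <= c < m is determined by its residues
    modulo the p_i and by the quotient c %/ P, and both sides of this
    correspondence have m elements.  Coefficientwise, it identifies (Z/m)G with
    the product of the (Z/p_i)G and of the functions from G to {0..m/P - 1},
    and the units are the elements whose components in all the (Z/p_i)G are
    units; the functions are unconstrained and contribute (m/P) ^ |G|. *)

(** * Divisibility by products of pairwise coprime numbers *)

Lemma Zp_int_eq0 n (z : int) : (1 < n)%N ->
  (z%:~R == 0 :> 'Z_n) = (n%:Z %| z)%Z.
Proof.
move=> n_gt1; have Enat k : (k%:R == 0 :> 'Z_n) = (n %| k)%N.
  by rewrite -val_eqE /= val_Zp_nat.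
by case: z => k; rewrite ?NegzE ?mulrNz ?oppr_eq0 -pmulrn Enat dvdzE ?abszN.
Qed.

Lemma coprime_prodr (I : Type) (s : seq I) (P : pred I) (F : I -> nat) n :
  (forall i, P i -> coprime n (F i)) -> coprime n (\prod_(i <- s | P i) F i)%N.
Proof.
move=> co_nF; elim/big_ind: _ => [|a b co_a co_b|//]; first exact: coprimen1.
by rewrite coprimeMr co_a.
Qed.

Lemma dvdn_prod_coprime (j : nat) (q : 'I_j -> nat) (d : nat) :
  (forall i k, i != k -> coprime (q i) (q k)) ->
  (\prod_(i < j) q i %| d)%N = [forall i, q i %| d]%N.
Proof.
move=> co_q; rewrite -big_enum /=; apply/idP/forallP => [dv i | dv].
  by apply: dvdn_trans dv; rewrite big_enum (bigD1 i) //= dvdn_mulr.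
elim: (enum _) (enum_uniq 'I_j) => [|i s IHs] /=; first by rewrite big_nil.
case/andP=> i_s /IHs dv_s; rewrite big_cons Gauss_dvd ?dv ?dv_s //.
rewrite big_seq; apply: coprime_prodr => k k_s; apply: co_q.
by apply: contraNneq i_s => ->.
Qed.

(** * Reduction of integral group rings *)

Section Reduction.
Variables (gT : finGroupType).
Local Notation ZG := (group_ring int gT).
Local Notation red n := (@group_ring_mod n gT).

Fact group_ring_mod_additive n : zmod_morphism (red n).
Proof. by move=> f g; apply/ffunP=> x; rewrite !ffunE rmorphB. Qed.

Fact group_ring_mod_multiplicative n : monoid_morphism (red n).
Proof.
split=> [|f g]; apply/ffunP=> x; rewrite !ffunE; first by rewrite rmorph_nat.
by rewrite rmorph_sum; apply: eq_bigr => y _; rewrite rmorphM !ffunE.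
Qed.

HB.instance Definition _ n := GRing.isZmodMorphism.Build ZG
  (group_ring 'Z_n gT) (red n) (group_ring_mod_additive n).
HB.instance Definition _ n := GRing.isMonoidMorphism.Build ZG
  (group_ring 'Z_n gT) (red n) (group_ring_mod_multiplicative n).

(** The representative with coefficients in [0, n), which the counting argument
    divides by the product of the primes. *)
Definition group_ring_lift n (u : group_ring 'Z_n gT) : ZG :=
  [ffun x => (u x : nat)%:Z].

Lemma group_ring_liftK n : cancel (@group_ring_lift n) (red n).
Proof. by move=> u; apply/ffunP=> x; rewrite !ffunE -pmulrn natr_Zp. Qed.

Lemma group_ring_mod_eqP n (f g : ZG) : (1 < n)%N ->
  red n f = red n g <-> forall x, (n%:Z %| f x - g x)%Z.
Proof.
move=> n_gt1; split=> [/ffunP Efg x | dv_fg].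
  by have /eqP := Efg x; rewrite !ffunE -subr_eq0 -rmorphB /= Zp_int_eq0.
apply/ffunP=> x; apply/eqP; rewrite !ffunE -subr_eq0 -rmorphB /=.
by rewrite Zp_int_eq0.
Qed.

Lemma group_ring_mod_dvd d n (f g : ZG) : (1 < d)%N -> (1 < n)%N ->
  (d %| n)%N -> red n f = red n g -> red d f = red d g.
Proof.
move=> d_gt1 n_gt1 dv_dn /group_ring_mod_eqP dv_fg.
by apply/group_ring_mod_eqP=> // x; apply: dvdz_trans (dv_fg n_gt1 x).
Qed.

Lemma group_ring_natE n (f : ZG) x : (n%:R * f) x = n%:Z * f x.
Proof. by rewrite mulr_natl ffunMnE -mulr_natl natz. Qed.

Lemma group_ring_mod_eq0P n (f : ZG) : (1 < n)%N ->
  red n f = 0 <-> exists h, f = n%:R * h.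
Proof.
move=> n_gt1; split=> [|[h ->]].
  rewrite -[0](rmorph0 (red n)) => /group_ring_mod_eqP-/(_ n_gt1) dv_f.
  exists [ffun x => (f x %/ n)%Z]; apply/ffunP=> x.
  rewrite group_ring_natE ffunE mulrC divzK //.
  by have := dv_f x; rewrite ffunE subr0.
rewrite -[RHS](rmorph0 (red n)); apply/group_ring_mod_eqP => // x.
by rewrite group_ring_natE ffunE subr0 dvdz_mulr.
Qed.

Lemma group_ring_mod_nat n k : (1 < n)%N ->
  red n k%:R = (k %% n)%:R.
Proof.
move=> n_gt1; rewrite rmorph_nat {1}(divn_eq k n) natrD natrM.
suff -> : n%:R = 0 :> group_ring 'Z_n gT by rewrite mulr0 add0r.
rewrite -(rmorph_nat (red n)); apply/group_ring_mod_eq0P => //.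
by exists 1; rewrite mulr1.
Qed.

(** If b is 1 modulo p ^ k with k > 0, then b ^ p - 1 is the product of b - 1,
    which is 0 modulo p ^ k, and of 1 + b + ... + b ^ (p - 1), which is p = 0
    modulo p; so b ^ p is 1 modulo p ^ (k + 1).  The conclusion iterates this
    r - 1 times. *)
Lemma group_ring_mod_exp_lift p r (a : ZG) : (1 < p)%N -> (0 < r)%N ->
  red p a = 1 -> red (p ^ r) (a ^+ (p ^ (r - 1))) = 1.
Proof.
move=> p_gt1 + a1; case: r => // r _; rewrite subn1 /=.
elim: r => [|r IHr]; first by rewrite expn1 expr1.
have gt1 k : (1 < p ^ k.+1)%N by rewrite -[1%N](exp1n k.+1) ltn_exp2r.
set b := a ^+ (p ^ r) in IHr *.
have b1 : red p b = 1 by rewrite rmorphXn /= a1 expr1n.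
have /group_ring_mod_eq0P[//|h Eh] : red (p ^ r.+1) (b - 1) = 0.
  by rewrite rmorphB /= IHr rmorph1 subrr.
have /group_ring_mod_eq0P[//|h' Eh'] : red p (\sum_(i < p) b ^+ i) = 0.
  rewrite rmorph_sum (eq_bigr (fun=> 1)) => [|i _]; last first.
    by rewrite rmorphXn /= b1 expr1n.
  rewrite sumr_const card_ord -(rmorph_nat (red p)) /= group_ring_mod_nat //.
  by rewrite modnn.
apply/eqP; rewrite -subr_eq0 -(rmorph1 (red _)) -rmorphB /=; apply/eqP.
apply/group_ring_mod_eq0P => //; exists (h * h').
rewrite expnSr exprM -/b subrX1 Eh Eh' -!mulrA [h * (_ * _)]mulrA.
by rewrite (commr_nat h p) !mulrA -natrM -expnSr.
Qed.

(** The substitution y := y^-1 * x exchanges the two factors of the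
    convolution. *)
Lemma group_ring_comm (R : comNzRingType) (f g : group_ring R gT) :
  abelian [set: gT] -> GRing.comm f g.
Proof.
move=> /centsP cG; apply/ffunP=> x; rewrite !group_ringME.
have inj : injective (fun y => y^-1 * x)%g by move=> y z /mulIg/invg_inj.
rewrite (reindex_inj inj) /=; apply: eq_bigr => y _.
rewrite mulrC; congr (g _ * _).
by rewrite invMg invgK -mulgA (cG y _ x) ?inE // mulKg.
Qed.

Lemma unit_group_ring_mod_dvd d n (f : ZG) : (1 < d)%N -> (1 < n)%N ->
  (d %| n)%N -> red n f \is a GRing.unit -> red d f \is a GRing.unit.
Proof.
move=> d_gt1 n_gt1 dv_dn /unitrP[g [gf fg]]; apply/unitrP.
exists (red d (group_ring_lift g)); rewrite -!rmorphM -(rmorph1 (red d)) /=.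
by split; apply: (group_ring_mod_dvd d_gt1 n_gt1 dv_dn);
   rewrite rmorphM /= group_ring_liftK rmorph1.
Qed.

(** * The modulus as a product of prime powers *)

Section PrimeFactorization.
Variables (j : nat) (p r : 'I_j -> nat).
Hypothesis gT_abelian : abelian [set: gT].
Hypothesis p_prime : forall i, prime (p i).
Hypothesis p_inj : injective p.
Hypothesis r_ge1 : forall i, (1 <= r i)%N.
Local Notation m := (\prod_(i < j) p i ^ r i)%N.
Local Notation cofactor i := (m %/ p i ^ r i)%N.
Hypothesis m_gt1 : (1 < m)%N.

Lemma prime_power_gt1 i : (1 < p i ^ r i)%N.
Proof. by rewrite -[1%N](exp1n (r i)) ltn_exp2r ?prime_gt1. Qed.

Lemma coprime_primes i k : i != k -> coprime (p i) (p k).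
Proof.
by move=> ik; rewrite prime_coprime // dvdn_prime2 // (inj_eq p_inj).
Qed.

Lemma coprime_prime_powers i k : i != k -> coprime (p i ^ r i) (p k ^ r k).
Proof. by move=> ik; rewrite coprimeXl ?coprimeXr ?coprime_primes. Qed.

Lemma dvdn_prime_power i : (p i ^ r i %| m)%N.
Proof. by rewrite (bigD1 i) //= dvdn_mulr. Qed.

Lemma cofactorE i : cofactor i = (\prod_(k < j | k != i) p k ^ r k)%N.
Proof. by rewrite (bigD1 i) //= mulKn // expn_gt0 prime_gt0. Qed.

Lemma coprime_cofactor i : coprime (p i ^ r i) (cofactor i).
Proof.
rewrite cofactorE; apply: coprime_prodr => k ki.
by rewrite coprime_prime_powers // eq_sym.
Qed.

(** Injectivity in the Chinese remainder theorem, coefficient by coefficient. *)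
Lemma group_ring_mod_chinese (f g : ZG) :
  (forall i, red (p i ^ r i) f = red (p i ^ r i) g) -> red m f = red m g.
Proof.
move=> Efg; apply/group_ring_mod_eqP => // x.
rewrite dvdzE /= (dvdn_prod_coprime _ coprime_prime_powers).
apply/forallP=> i; have /group_ring_mod_eqP := Efg i.
by move/(_ (prime_power_gt1 i))/(_ x); rewrite dvdzE.
Qed.

(** The s k * cofactor k are orthogonal idempotents modulo the product: modulo
    p i ^ r i, the one of index i is 1 and the others are 0. *)
Lemma group_ring_mod_chinese_sum (s : 'I_j -> nat) (f : 'I_j -> ZG) :
    (forall i, s i * cofactor i = 1 %[mod p i ^ r i])%N ->
  forall i, red (p i ^ r i) (\sum_(k < j) (s k * cofactor k)%:R * f k)
    = red (p i ^ r i) (f i).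
Proof.
move=> s_inv i; have q_gt1 := prime_power_gt1 i.
rewrite rmorph_sum (bigD1 i) //= rmorphM /= group_ring_mod_nat // s_inv.
rewrite modn_small // mul1r big1 ?addr0 // => k ki.
rewrite rmorphM /= group_ring_mod_nat //.
suff /eqP-> : (p i ^ r i %| s k * cofactor k)%N by rewrite mul0r.
by rewrite dvdn_mull // cofactorE (bigD1 i) 1?eq_sym //= dvdn_mulr.
Qed.

(** Modulo p i ^ r i the product is (f i * g i) ^ alpha with
    alpha = p i ^ (r i - 1), exactly the exponent that lifts the congruence
    f i * g i = 1 from p i to p i ^ r i. *)
Lemma group_ring_mod_chinese_sum_inverse (s : 'I_j -> nat) (f g : 'I_j -> ZG) :
    (forall i, s i * cofactor i = 1 %[mod p i ^ r i])%N ->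
    (forall i, red (p i) (f i) * red (p i) (g i) = 1) ->
  red m (\sum_(i < j) (s i * cofactor i)%:R * f i) *
  red m (\sum_(i < j) (s i * cofactor i)%:R *
     g i ^+ (p i ^ (r i - 1)) * f i ^+ (p i ^ (r i - 1) - 1)) = 1.
Proof.
move=> s_inv fg1; rewrite -rmorphM -(rmorph1 (red m)) /=.
apply: group_ring_mod_chinese => i; rewrite rmorphM /=.
under [in X in _ * red _ X]eq_bigr => k _ do rewrite -mulrA.
rewrite !group_ring_mod_chinese_sum // -rmorphM rmorph1 /=.
have fC h : GRing.comm (f i) h by apply: group_ring_comm.
rewrite mulrA (commrX _ (fC _)) -mulrA -exprS.
rewrite [(_ ^ _ - 1)%N]subn1 prednK ?expn_gt0 ?prime_gt0 //.
rewrite -exprMn_comm; last exact/commr_sym/fC.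
rewrite -(fC (g i)); apply: group_ring_mod_exp_lift => //.
  exact: prime_gt1.
by rewrite rmorphM /= fg1.
Qed.

Lemma unit_group_ring_mod_chinese_sum (s : 'I_j -> nat) (f : 'I_j -> ZG) :
    (forall i, s i * cofactor i = 1 %[mod p i ^ r i])%N ->
    (forall i, red (p i) (f i) \is a GRing.unit) ->
  red m (\sum_(i < j) (s i * cofactor i)%:R * f i) \is a GRing.unit.
Proof.
move=> s_inv f_unit; pose g i := group_ring_lift (red (p i) (f i))^-1.
have fg1 i : red (p i) (f i) * red (p i) (g i) = 1.
  by rewrite group_ring_liftK; exact: mulrV (f_unit i).
have := group_ring_mod_chinese_sum_inverse s_inv fg1.
set F := red m _; set H := red m _ => FH1; apply/unitrP; exists H; split=> //.
by rewrite (group_ring_comm H F gT_abelian).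
Qed.

(** Bezout coefficients for p i ^ r i and its coprime cofactor. *)
Lemma exists_cofactor_inverse :
  exists s : 'I_j -> nat, forall i, (s i * cofactor i = 1 %[mod p i ^ r i])%N.
Proof.
have inv_ex i : exists t, (t * cofactor i == 1 %[mod p i ^ r i])%N.
  have := coprime_cofactor i; rewrite coprime_sym.
  case/coprimeP=> [|[t u] /= E].
    by rewrite cofactorE prodn_cond_gt0 // => k _; rewrite expn_gt0 prime_gt0.
  exists t; have le : (u * p i ^ r i <= t * cofactor i)%N.
    by rewrite ltnW // -subn_gt0 E.
  by rewrite -(subnK le) E addnC modnMDl.
exists (fun i => xchoose (inv_ex i)) => i.
exact/eqP/(xchooseP (inv_ex i)).
Qed.

(** The converse direction recombines the constant family f: the Chinese sum of
    copies of f is f itself modulo the product. *)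
Lemma unit_group_ring_modE (f : ZG) :
  (red m f \is a GRing.unit) = [forall i, red (p i) f \is a GRing.unit].
Proof.
apply/idP/forallP => [f_unit i | f_unit].
  apply: unit_group_ring_mod_dvd f_unit => //; first exact: prime_gt1.
  by apply: dvdn_trans (dvdn_prime_power i); rewrite dvdn_exp.
have [s s_inv] := exists_cofactor_inverse.
have <- : red m (\sum_(i < j) (s i * cofactor i)%:R * f) = red m f.
  apply: group_ring_mod_chinese => i.
  by rewrite (group_ring_mod_chinese_sum (fun=> f)).
exact: (unit_group_ring_mod_chinese_sum (f := fun=> f)).
Qed.

(** * Counting units *)

Lemma card_group_ring_Zp n : (1 < n)%N ->
  #|{: group_ring 'Z_n gT}| = (n ^ #|gT|)%N.
Proof. by move=> n_gt1; rewrite card_ffun card_ord Zp_cast. Qed.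

Lemma card_unit_group_ring n :
  #|[set: {unit group_ring 'Z_n gT}]|
    = #|[pred u : group_ring 'Z_n gT | u \is a GRing.unit]|.
Proof. by rewrite cardsT card_sub. Qed.

(** Residues modulo the primes and quotients by their product P determine the
    coefficients, since they determine them modulo P and divided by P.  As the
    two sides have the same cardinality, injectivity suffices for the
    bijection. *)
Lemma card_unit_group_ring_prime_factorization :
  #|[set: {unit group_ring 'Z_m gT}]| =
    ((m %/ \prod_(i < j) p i) ^ #|gT| *
       \prod_(i < j) #|[set: {unit group_ring 'Z_(p i) gT}]|)%N.
Proof.
set P := (\prod_(i < j) p i)%N; set k := (m %/ P)%N.
have P_gt0 : (0 < P)%N by apply: prodn_gt0 => i; rewrite prime_gt0.
have mE : (k * P)%N = m.
  rewrite divnK // (dvdn_prod_coprime _ coprime_primes); apply/forallP=> i.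
  by apply: dvdn_trans (dvdn_prime_power i); rewrite dvdn_exp.
pose residues (u : group_ring 'Z_m gT) :
    {dffun forall i : 'I_j, group_ring 'Z_(p i) gT} :=
  [ffun i => red (p i) (group_ring_lift u)].
have ltk (u : group_ring 'Z_m gT) x : (u x %/ P < k)%N.
  by rewrite ltn_divLR // mE -[X in (_ < X)%N](Zp_cast m_gt1).
pose quotients (u : group_ring 'Z_m gT) : {ffun gT -> 'I_k} :=
  [ffun x => Ordinal (ltk u x)].
pose phi u := (residues u, quotients u).
have phi_inj : injective phi.
  move=> u v [/ffunP Er /ffunP Eq]; apply/ffunP=> x; apply/val_inj.
  have /(congr1 val) := Eq x; rewrite !ffunE /= => Ed.
  rewrite /= (divn_eq (u x) P) (divn_eq (v x) P) Ed; congr (_ + _)%N.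
  apply/eqP; wlog le_vu: u v Er Eq Ed / (v x <= u x)%N.
    move=> IH; have [/IH-> //|/ltnW/IH E] := leqP (v x) (u x).
    by rewrite eq_sym E // => i; rewrite ?Er ?Eq.
  rewrite eqn_mod_dvd // (dvdn_prod_coprime _ coprime_primes).
  apply/forallP=> i; have := Er i; rewrite !ffunE.
  move/group_ring_mod_eqP=> /(_ (prime_gt1 (p_prime i)) x).
  by rewrite !ffunE dvdzE subzn.
have card_dom : (\prod_(i < j) #|{: group_ring 'Z_(p i) gT}| *
     #|{ffun gT -> 'I_k}| = #|{: group_ring 'Z_m gT}|)%N.
  rewrite card_group_ring_Zp // card_ffun card_ord -mE expnMn mulnC.
  congr (_ * _)%N.
  rewrite /P (big_morph (expn^~ #|gT|) (fun a b => expnMn a b _) (exp1n _)).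
  by apply: eq_bigr => i _; rewrite card_group_ring_Zp ?prime_gt1.
have phi_bij : bijective phi.
  apply: inj_card_bij => //; rewrite card_prod card_dep_ffun.
  by rewrite foldrE big_map big_enum /= card_dom.
pose U (i : 'I_j) := [pred u : group_ring 'Z_(p i) gT | u \is a GRing.unit].
pose FU : {pred {dffun forall i : 'I_j, group_ring 'Z_(p i) gT}} := family U.
pose B := [predX FU & {ffun gT -> 'I_k}].
have -> : #|[set: {unit group_ring 'Z_m gT}]| = #|B|.
  rewrite card_unit_group_ring -(on_card_preimset (onW_bij _ phi_bij)).
  apply: eq_card => u; rewrite !inE -{1}[u]group_ring_liftK.
  rewrite unit_group_ring_modE andbT; apply: eq_forallb => i.
  by rewrite ffunE.
rewrite cardX card_ffun card_ord mulnC card_family foldrE big_map big_enum /=.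
by congr (_ * _)%N; apply: eq_bigr => i _; rewrite card_unit_group_ring.
Qed.

End PrimeFactorization.
End Reduction.

Theorem theorem4p16 (gT : finGroupType) (m j : nat) (p r : 'I_j -> nat)
    (gT_abelian : abelian [set: gT])
    (m_ge2 : (2 <= m)%N)
    (p_prime : forall i, prime (p i))
    (p_inj : injective p)
    (r_ge1 : forall i, (1 <= r i)%N)
    (m_def : m = (\prod_(i < j) p i ^ r i)%N) :
  let m_ (i : 'I_j) := (m %/ p i ^ r i)%N in
  let alpha (i : 'I_j) := (p i ^ (r i - 1))%N in
  (forall (s : 'I_j -> nat) (f : 'I_j -> group_ring int gT),
     (forall i, s i * m_ i = 1 %[mod p i ^ r i])%N ->
     (forall i, group_ring_mod (p i) (f i) \is a GRing.unit) ->
     let F := group_ring_mod m (\sum_(i < j) (s i * m_ i)%:R * f i) in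
     F \is a GRing.unit /\
     (forall g : 'I_j -> group_ring int gT,
        (forall i, group_ring_mod (p i) (f i) * group_ring_mod (p i) (g i) = 1) ->
        F^-1 = group_ring_mod m
          (\sum_(i < j) (s i * m_ i)%:R * g i ^+ alpha i * f i ^+ (alpha i - 1))))
  /\
  #|[set: {unit group_ring 'Z_m gT}]| =
    ((m %/ \prod_(i < j) p i) ^ #|gT| *
       \prod_(i < j) #|[set: {unit group_ring 'Z_(p i) gT}]|)%N.
Proof.
subst m; move=> m_ alpha; split=> [s f s_inv f_unit F|]; last first.
  exact: card_unit_group_ring_prime_factorization.
have F_unit : F \is a GRing.unit by apply: unit_group_ring_mod_chinese_sum.
split=> // g fg1; apply: (mulrI F_unit); rewrite mulrV //.
by rewrite group_ring_mod_chinese_sum_inverse.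
Qed.
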